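(* Let $R$ be a ring, let $\{f_k:M_k\to N_k\}_{k\in K}$ be a set of homomorphisms of left $R$-modules, and let $\mathcal{I}$ be the closure under direct sums of the ideal generated by this set. Then $\mathcal{I}$ is a precovering ideal, i.e. every left $R$-module has an $\mathcal{I}$-precover.
   Context: $R$ is an arbitrary ring; modules are left $R$-modules. An ideal is an additive subfunctor of $\operatorname{Hom}_R$, i.e. a class $\mathcal{I}$ of $R$-homomorphisms such that for all modules $M,N$ the members of $\mathcal I$ from $M$ to $N$ form a subgroup of $\operatorname{Hom}_R(M,N)$, and $f\circ g\circ h\in\mathcal{I}$ whenever $g\in\mathcal{I}$ and $f,h$ are composable homomorphisms. The ideal generated by a set of homomorphisms is the smallest ideal containing that set. An ideal $\mathcal{I}$ is closed under sums if for every (set-indexed) family $(g_j:A_j\to B_j)_{j\in J}$ of elements of $\mathcal{I}$ the homomorphism $\bigoplus_{j}g_j:\bigoplus_j A_j\to\bigoplus_j B_j$ is in $\mathcal{I}$; equivalently, for every family $(g_j:A_j\to B)_{j\in J}$ in $\mathcal{I}$ the map $\bigoplus_j A_j\to B$, $(x_j)\mapsto\sum_j g_j(x_j)$, is in $\mathcal{I}$. The closure under direct sums of an ideal is the smallest ideal containing it that is closed under sums. An $\mathcal{I}$-precover of a module $V$ is a homomorphism $i:A\to V$ in $\mathcal{I}$ such that every homomorphism $i':A'\to V$ in $\mathcal{I}$ factors as $i'=i\circ h$ for some homomorphism $h:A'\to A$. *)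

(* Defs.v *)
From HB Require Import structures.
From mathcomp Require Import all_boot all_algebra.
From mathcomp Require Import boolp classical_sets functions cardinality.

Set Implicit Arguments.
Unset Strict Implicit.
Unset Printing Implicit Defensive.

Import GRing.Theory.
Local Open Scope classical_set_scope.
Local Open Scope ring_scope.

(* The direct sum of an arbitrary family of modules: the families with finite
   support, with componentwise operations. *)
Section DirectSum.
Variables (R : pzRingType) (J : Type).

Record dsum (A : J -> lmodType R) := DSum {
  dsum_fun :> forall j, A j;
  dsum_finite_supp : finite_set [set j | dsum_fun j <> 0]
}.

Lemma dsumP (A : J -> lmodType R) (x y : dsum A) :
  (forall j, x j = y j) -> x = y.
Proof.
case: x y => [x xP] [y yP] /= exy.
have e : x = y by apply: functional_extensionality_dep.
by rewrite e in xP *; congr DSum; exact: Prop_irrelevance.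
Qed.

Section Structure.
Variable A : J -> lmodType R.
Implicit Types (x y : dsum A) (a : R).

HB.instance Definition _ := gen_eqMixin (dsum A).
HB.instance Definition _ := gen_choiceMixin (dsum A).

Lemma dsum_zero_subproof : finite_set [set j | (0 : A j) <> 0].
Proof. by apply: (sub_finite_set _ (finite_set0 J)) => j /=. Qed.

Lemma dsum_opp_subproof x : finite_set [set j | - x j <> 0].
Proof.
apply: (sub_finite_set _ (dsum_finite_supp x)) => j /= nz e; apply: nz.
by rewrite e oppr0.
Qed.

Lemma dsum_add_subproof x y : finite_set [set j | x j + y j <> 0].
Proof.
have fxy : finite_set ([set j | x j <> 0] `|` [set j | y j <> 0]).
  by rewrite finite_setU; split; exact: dsum_finite_supp.
apply: (sub_finite_set _ fxy) => j /= nz.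
have [ex|] := pselect (x j = 0); last by left.
by right => ey; apply: nz; rewrite ex ey addr0.
Qed.

Lemma dsum_scale_subproof a x : finite_set [set j | a *: x j <> 0].
Proof.
apply: (sub_finite_set _ (dsum_finite_supp x)) => j /= nz e; apply: nz.
by rewrite e scaler0.
Qed.

Definition dsum_zero : dsum A := DSum dsum_zero_subproof.
Definition dsum_opp x : dsum A := DSum (dsum_opp_subproof x).
Definition dsum_add x y : dsum A := DSum (dsum_add_subproof x y).
Definition dsum_scale a x : dsum A := DSum (dsum_scale_subproof a x).

Lemma dsum_addA : associative dsum_add.
Proof. by move=> x y z; apply: dsumP => j; exact: addrA. Qed.
Lemma dsum_addC : commutative dsum_add.
Proof. by move=> x y; apply: dsumP => j; exact: addrC. Qed.
Lemma dsum_add0 : left_id dsum_zero dsum_add.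
Proof. by move=> x; apply: dsumP => j; exact: add0r. Qed.
Lemma dsum_addN : left_inverse dsum_zero dsum_opp dsum_add.
Proof. by move=> x; apply: dsumP => j; exact: addNr. Qed.

HB.instance Definition _ := GRing.isZmodule.Build (dsum A)
  dsum_addA dsum_addC dsum_add0 dsum_addN.

Lemma dsum_scaleA a b x : dsum_scale a (dsum_scale b x) = dsum_scale (a * b) x.
Proof. by apply: dsumP => j; exact: scalerA. Qed.
Lemma dsum_scale1 : left_id 1 dsum_scale.
Proof. by move=> x; apply: dsumP => j; exact: scale1r. Qed.
Lemma dsum_scaleDr : right_distributive dsum_scale +%R.
Proof. by move=> a x y; apply: dsumP => j; exact: scalerDr. Qed.
Lemma dsum_scaleDl x : {morph dsum_scale^~ x : a b / a + b}.
Proof. by move=> a b; apply: dsumP => j; exact: scalerDl. Qed.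

HB.instance Definition _ := GRing.Zmodule_isLmodule.Build R (dsum A)
  dsum_scaleA dsum_scale1 dsum_scaleDr dsum_scaleDl.

End Structure.

Section Map.
Variables (A B : J -> lmodType R) (g : forall j, {linear A j -> B j}).

Lemma dsum_map_subproof (x : dsum A) : finite_set [set j | g j (x j) <> 0].
Proof.
apply: (sub_finite_set _ (dsum_finite_supp x)) => j /= nz e; apply: nz.
by rewrite e linear0.
Qed.

Definition dsum_map (x : dsum A) : dsum B := DSum (dsum_map_subproof x).

Lemma dsum_map_is_linear : linear dsum_map.
Proof. by move=> a x y; apply: dsumP => j; exact: linearP. Qed.

HB.instance Definition _ :=
  GRing.isLinear.Build R (dsum A) (dsum B) *:%R dsum_map dsum_map_is_linear.

End Map.
End DirectSum.

Definition hom_class (R : pzRingType) : Type :=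
  forall M N : lmodType R, {linear M -> N} -> Prop.

Record is_ideal (R : pzRingType) (I : hom_class R) : Prop := {
  ideal0 : forall M N : lmodType R, I M N \0;
  idealD : forall (M N : lmodType R) (g g' : {linear M -> N}),
    I M N g -> I M N g' -> I M N (g \+ g');
  idealN : forall (M N : lmodType R) (g : {linear M -> N}),
    I M N g -> I M N (\- g);
  ideal_comp : forall (M' M N N' : lmodType R) (f : {linear N -> N'})
      (g : {linear M -> N}) (h : {linear M' -> M}),
    I M N g -> I M' N' (f \o g \o h)
}.

Definition closed_under_sums (R : pzRingType) (I : hom_class R) : Prop :=
  forall (J : Type) (A B : J -> lmodType R) (g : forall j, {linear A j -> B j}),
    (forall j, I (A j) (B j) (g j)) -> I (dsum A) (dsum B) (dsum_map g).

Definition ideal_generated (R : pzRingType) (K : Type) (M N : K -> lmodType R)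
    (f : forall k, {linear M k -> N k}) : hom_class R :=
  fun A B g => forall I : hom_class R,
    is_ideal I -> (forall k, I (M k) (N k) (f k)) -> I A B g.

Definition sum_closure (R : pzRingType) (I : hom_class R) : hom_class R :=
  fun A B g => forall I' : hom_class R,
    is_ideal I' -> closed_under_sums I' ->
    (forall (M N : lmodType R) (h : {linear M -> N}), I M N h -> I' M N h) ->
    I' A B g.

Definition is_precover (R : pzRingType) (I : hom_class R) (V A : lmodType R)
    (i : {linear A -> V}) : Prop :=
  I A V i /\
  forall (A' : lmodType R) (i' : {linear A' -> V}), I A' V i' ->
    exists h : {linear A' -> A}, i' =1 i \o h.

Definition precovering_ideal (R : pzRingType) (I : hom_class R) : Prop :=
  is_ideal I /\
  forall V : lmodType R,
    exists (A : lmodType R) (i : {linear A -> V}), is_precover I i.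

Section Closures.
Variable R : pzRingType.

Lemma ideal_generated_ideal (K : Type) (M N : K -> lmodType R)
  (f : forall k, {linear M k -> N k}) : is_ideal (ideal_generated f).
Proof.
split=> [A B|A B g g' Ig Ig'|A B g Ig|A' A B B' u g v Ig] I II If.
- exact: ideal0.
- by apply: idealD; [|exact: Ig|exact: Ig'].
- by apply: idealN; [|exact: Ig].
- by apply: ideal_comp; [|exact: Ig].
Qed.

Lemma mem_ideal_generated (K : Type) (M N : K -> lmodType R)
  (f : forall k, {linear M k -> N k}) k : ideal_generated f (f k).
Proof. by move=> I _; exact. Qed.

Lemma sum_closure_ideal (I : hom_class R) : is_ideal (sum_closure I).
Proof.
split=> [A B|A B g g' Ig Ig'|A B g Ig|A' A B B' u g v Ig] I' II' SI' sub.
- exact: ideal0.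
- by apply: idealD; [|exact: Ig|exact: Ig'].
- by apply: idealN; [|exact: Ig].
- by apply: ideal_comp; [|exact: Ig].
Qed.

Lemma sum_closure_sums (I : hom_class R) : closed_under_sums (sum_closure I).
Proof.
by move=> J A B g Ig I' II' SI' sub; apply: (SI') => j; exact: Ig.
Qed.

Lemma sub_sum_closure (I : hom_class R) (M N : lmodType R)
  (g : {linear M -> N}) : I M N g -> sum_closure I g.
Proof. by move=> Ig I' _ _; exact. Qed.

End Closures.

(* Main.v *)
Require Import Defs.
From HB Require Import structures.
From mathcomp Require Import all_boot all_algebra.
From mathcomp Require Import boolp classical_sets cardinality fsbigop.

Set Implicit Arguments.
Unset Strict Implicit.
Unset Printing Implicit Defensive.

(** Fix a module [V] and take one copy of [M k] for every pair [(k, phi)] with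
    [phi : N k -> V] linear: such pairs form a set, so the direct sum of these
    copies is a module, and the maps [phi \o f k] assemble into a map [i] from
    it to [V] ([generated_precover]).  It is the summation map of copies of
    [V] composed with the direct sum of the members [phi \o f k] of the ideal
    generated by [f], hence it lies in the closure of that ideal under direct
    sums.

    It remains to see that every member [g : A -> V] of that closure factors
    through [i].  The closure being the smallest ideal closed under sums that
    contains the [f k], it suffices that the maps factoring through the
    [generated_precover] of their codomain form such an ideal
    ([lift_ideal], [lift_closed_under_sums], [lift_generators]).  What makes
    this work is naturality: composing with [u : V -> W] sends the summand
    [(k, phi)] to the summand [(k, u \o phi)], so [u \o i] factors through the
    precover of [W] ([generated_precover_natural]).  This gives stability
    under composition on the left.  It also settles direct sums: each summand
    [g j], followed by the inclusion of [B j], factors through the precover of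
    the sum of the [B j], and these factorizations add up by the universal
    property of the direct sum. *)

Import GRing.Theory.
Local Open Scope classical_set_scope.
Local Open Scope ring_scope.

(** * The universal property of the direct sum *)

Section Coproduct.
Variables (R : pzRingType) (J : Type) (A : J -> lmodType R).

(** The value at [j'] transports [a] along an equality of indices, and is [0]
    when [j' <> j]. *)
Definition dsum_inj_fun j (a : A j) j' : A j' :=
  if pselect (j = j') is left e then eq_rect j (fun j => A j) a j' e else 0.

Lemma dsum_inj_fun_id j (a : A j) : dsum_inj_fun a j = a.
Proof.
rewrite /dsum_inj_fun; case: pselect => // e.
by rewrite (Prop_irrelevance e erefl).
Qed.

Lemma dsum_inj_fun_neq j (a : A j) j' : j <> j' -> dsum_inj_fun a j' = 0.
Proof. by rewrite /dsum_inj_fun; case: pselect. Qed.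

Lemma dsum_inj_subproof j (a : A j) :
  finite_set [set j' | dsum_inj_fun a j' <> 0].
Proof.
apply: (sub_finite_set _ (finite_set1 j)) => j' /= nz.
by apply: contrapT => nej; apply/nz/dsum_inj_fun_neq => e; apply: nej.
Qed.

Definition dsum_inj j (a : A j) : dsum A := DSum (dsum_inj_subproof a).

Lemma dsum_inj_is_linear j : linear (@dsum_inj j).
Proof.
move=> a x y; apply: dsumP => j' /=.
have [e|nej] := pselect (j = j'); last first.
  by rewrite !dsum_inj_fun_neq// scaler0 addr0.
by case: j' / e; rewrite !dsum_inj_fun_id.
Qed.

HB.instance Definition _ j :=
  GRing.isLinear.Build R (A j) (dsum A) *:%R (@dsum_inj j)
    (@dsum_inj_is_linear j).

Section Copairing.
Variables (B : lmodType R) (phi : forall j, {linear A j -> B}).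

(** Indices are given the classical choice structure that finitely supported
    sums require. *)
Definition dsum_copair (x : dsum A) : B :=
  \sum_(j \in [set: {classic J}]) phi j (x j).

Lemma dsum_copair_seq (s : seq {classic J}) (x : dsum A) : uniq s ->
  (forall j : {classic J}, x j <> 0 -> j \in s) -> dsum_copair x = \sum_(j <- s) phi j (x j).
Proof.
move=> us sP; rewrite /dsum_copair (fsbigE s)//.
  by apply: eq_bigl => j; rewrite in_setT.
move=> j _ /negP js; have -> : x j = 0 by apply: contrapT => /sP.
by rewrite linear0.
Qed.

End Copairing.

Lemma dsum_supp_seq (x : dsum A) :
  exists s : seq {classic J}, forall j : {classic J}, x j <> 0 -> j \in s.
Proof.
have /(@finite_seqP {classic J})[s sE] := dsum_finite_supp x.
by exists s => j xj; have : [set j | x j <> 0] j by []; rewrite sE.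
Qed.

Lemma dsum_copair_is_linear (B : lmodType R)
  (phi : forall j, {linear A j -> B}) : linear (dsum_copair phi).
Proof.
move=> a x y; have [s sP] := dsum_supp_seq x; have [t tP] := dsum_supp_seq y.
have us := undup_uniq (s ++ t).
rewrite !(@dsum_copair_seq _ _ (undup (s ++ t)))// => [|j|j|j].
- rewrite scaler_sumr -big_split; apply: eq_bigr => j _ /=.
  by rewrite linearP.
- by move=> /tP jt; rewrite mem_undup mem_cat jt orbT.
- by move=> /sP js; rewrite mem_undup mem_cat js.
- move=> nz; rewrite mem_undup mem_cat; apply/orP.
  have [x0|/sP] := pselect (x j = 0); last by left.
  by right; apply: tP => y0; apply: nz; rewrite /= x0 y0 scaler0 addr0.
Qed.

HB.instance Definition _ (B : lmodType R) (phi : forall j, {linear A j -> B}) :=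
  GRing.isLinear.Build R (dsum A) B *:%R (dsum_copair phi)
    (dsum_copair_is_linear phi).

Lemma dsum_copair_inj (B : lmodType R) (phi : forall j, {linear A j -> B}) j
  (a : A j) : dsum_copair phi (dsum_inj a) = phi j a.
Proof.
rewrite (@dsum_copair_seq _ _ [:: j])// => [|j' /= nz].
  by rewrite big_seq1 /= dsum_inj_fun_id.
rewrite inE; apply/eqP; apply: contrapT => nej.
by apply/nz/dsum_inj_fun_neq => e; apply: nej.
Qed.

(** Uniqueness in the universal property, for the identity: copairing the
    inclusions recovers each element as the finite sum of its components. *)
Lemma dsum_copair_inj_id (x : dsum A) :
  dsum_copair (fun j => @dsum_inj j) x = x.
Proof.
have [s sP] := dsum_supp_seq x.
rewrite (@dsum_copair_seq _ _ (undup s)) ?undup_uniq// => [|j /sP]; last first.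
  by rewrite mem_undup.
apply: dsumP => j.
(* Evaluation at [j] is additive, which turns the goal into a sum in [A j]. *)
pose ev (y : dsum A) := y j.
have ev_sum (r : seq {classic J}) :
    ev (\sum_(i <- r) dsum_inj (x i)) = \sum_(i <- r) ev (dsum_inj (x i)).
  by apply: (big_morph ev).
rewrite -/(ev _) ev_sum /ev /=.
have [js|js] := boolP ((j : {classic J}) \in undup s).
  rewrite (bigD1_seq (j : {classic J})) ?undup_uniq//= dsum_inj_fun_id.
  rewrite big1 ?addr0// => i /eqP nij.
  by rewrite dsum_inj_fun_neq.
rewrite big1_seq; last first.
  move=> i /andP[_ si]; rewrite dsum_inj_fun_neq// => e.
  by rewrite -e si in js.
by apply/esym; apply: contrapT => /sP xj; rewrite mem_undup xj in js.
Qed.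

Lemma dsum_linear_ext (B : lmodType R) (u v : {linear dsum A -> B}) :
  (forall j (a : A j), u (dsum_inj a) = v (dsum_inj a)) -> u =1 v.
Proof.
move=> uv x; rewrite -(dsum_copair_inj_id x).
have [s sP] := dsum_supp_seq x.
rewrite (@dsum_copair_seq _ _ (undup s)) ?undup_uniq// => [|j /sP]; last first.
  by rewrite mem_undup.
by rewrite !linear_sum; apply: eq_bigr => j _; exact: uv.
Qed.

End Coproduct.

Lemma dsum_map_inj (R : pzRingType) (J : Type) (A B : J -> lmodType R)
  (g : forall j, {linear A j -> B j}) j (a : A j) :
  dsum_map g (dsum_inj a) = dsum_inj (g j a).
Proof.
apply: dsumP => j' /=; have [e|nej] := pselect (j = j').
  by case: j' / e; rewrite !dsum_inj_fun_id.
by rewrite !dsum_inj_fun_neq// linear0.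
Qed.

(** * The precover attached to a set of homomorphisms *)

Section Precover.
Variables (R : pzRingType) (K : Type) (M N : K -> lmodType R).
Variable f : forall k, {linear M k -> N k}.

Definition pre_index (V : lmodType R) : Type := {k & {linear N k -> V}}.

Definition pre_source (V : lmodType R) : lmodType R :=
  dsum (fun p : pre_index V => M (tag p)).

Definition pre_inj (V : lmodType R) (p : pre_index V) :
    {linear M (tag p) -> pre_source V} :=
  @dsum_inj R (pre_index V) (fun p => M (tag p)) p.

(** The trailing identity gives the map the shape in which ideals are closed
    under composition, so that membership holds without comparing linear maps
    up to extensional equality. *)
Definition generated_precover (V : lmodType R) : {linear pre_source V -> V} :=
  dsum_copair (fun _ : pre_index V => (idfun : {linear V -> V}))
    \o dsum_map (fun p : pre_index V => tagged p \o f (tag p) \o idfun)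
    \o idfun.

Lemma generated_precover_inj (V : lmodType R) (p : pre_index V)
  (m : M (tag p)) :
  generated_precover V (pre_inj p m) = tagged p (f _ m).
Proof. by rewrite /= dsum_map_inj dsum_copair_inj. Qed.

Lemma generated_precover_mem (V : lmodType R) :
  sum_closure (ideal_generated f) (generated_precover V).
Proof.
apply: (ideal_comp (sum_closure_ideal _)).
apply: sum_closure_sums => p; apply: sub_sum_closure.
apply: (ideal_comp (ideal_generated_ideal _)).
exact: mem_ideal_generated.
Qed.

(** [t] sends the summand [(k, phi)] identically to the summand
    [(k, u \o phi)]. *)
Lemma generated_precover_natural (V W : lmodType R) (u : {linear V -> W}) :
  exists t : {linear pre_source V -> pre_source W},
    u \o generated_precover V =1 generated_precover W \o t.
Proof.
pose reindex (p : pre_index V) : pre_index W :=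
  Tagged (fun k => {linear N k -> W}) (u \o tagged p : {linear _ -> _}).
pose t : {linear pre_source V -> pre_source W} :=
  dsum_copair (fun p => pre_inj (reindex p)).
exists t; apply: dsum_linear_ext => p m /=.
rewrite -[LHS]/(u (generated_precover V _)) generated_precover_inj.
rewrite -[RHS]/(generated_precover W _) dsum_copair_inj.
by rewrite generated_precover_inj.
Qed.

(** * The maps that lift to the precover of their codomain *)

Definition lift_class : hom_class R := fun A V g =>
  exists s : {linear A -> pre_source V}, g =1 generated_precover V \o s.

Lemma lift_comp (A V W : lmodType R) (g : {linear A -> V})
  (u : {linear V -> W}) : lift_class g -> lift_class (u \o g).
Proof.
move=> [s gs]; have [t ut] := generated_precover_natural u.
by exists (t \o s) => x; rewrite [LHS]/= gs; exact: ut.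
Qed.

Lemma lift_ideal : is_ideal lift_class.
Proof.
split=> [A V|A V g g' [s gs] [s' gs']|A V g [s gs]|A' A V W u g v Ig].
- by exists \0 => x; rewrite [RHS]linear0.
- by exists (s \+ s') => x; rewrite [RHS]linearD [LHS]/= gs gs'.
- by exists (\- s) => x; rewrite [RHS]linearN [LHS]/= gs.
- have [s us] := lift_comp u Ig.
  by exists (s \o v) => x; exact: us.
Qed.

(** The lifts [s j] are obtained after composing [g j] with the inclusion of
    [B j] into [dsum B], so that they all take values in one module, the source
    of the precover of [dsum B], where they can be added up. *)
Lemma lift_closed_under_sums : closed_under_sums lift_class.
Proof.
move=> J A B g Ig.
have lift j : exists s : {linear A j -> pre_source (dsum B)},
    @dsum_inj _ _ B j \o g j =1 generated_precover (dsum B) \o s.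
  exact: (lift_comp (@dsum_inj _ _ B j)).
pose s j := sval (cid (lift j)).
exists (dsum_copair s); apply: dsum_linear_ext => j a.
by rewrite [LHS]dsum_map_inj [RHS]/= dsum_copair_inj; exact: (svalP (cid (lift j))).
Qed.

(** [f k] is the inclusion of the summand indexed by the identity of [N k],
    followed by the precover. *)
Lemma lift_generators k : lift_class (f k).
Proof.
pose p : pre_index (N k) :=
  Tagged (fun k' => {linear N k' -> N k}) (idfun : {linear N k -> N k}).
exists (pre_inj p) => m.
by rewrite [RHS]generated_precover_inj.
Qed.

End Precover.

Theorem theorem5p2 (R : pzRingType) (K : Type) (M N : K -> lmodType R)
    (f : forall k : K, {linear M k -> N k}) :
  precovering_ideal (sum_closure (ideal_generated f)).
Proof.
split=> [|V]; first exact: sum_closure_ideal.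
exists (pre_source M N V), (generated_precover f V).
split=> [|A g Ig]; first exact: generated_precover_mem.
apply: (Ig (lift_class f)) => [||A' B' h Ih].
- exact: lift_ideal.
- exact: lift_closed_under_sums.
- by apply: Ih; [exact: lift_ideal|exact: lift_generators].
Qed.
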